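(* Let $\mathcal{F}$ be a nonempty family of graphs with $\chi(\mathcal{F})=r+1\geq 3$. Let $0< \varepsilon < \frac{1}{2}$, $0<\sigma<\frac{\varepsilon^3}{7}$ and $0\leq \alpha\leq 1-\frac{1}{r}-\varepsilon$. For each $n$ let $\mathcal{G}'_n$ be the set of all $\mathcal{F}$-free graphs on $n$ vertices with minimum degree larger than $(\pi(\mathcal{F})-\varepsilon)n$, and $\lambda_\alpha(\mathcal{G}'_n)=\max_{H\in\mathcal{G}'_n}\lambda_\alpha(H)$. Suppose there exists $N>0$ such that for every $n>N$, $$\left|\mathrm{ex}(n,\mathcal{F})-\mathrm{ex}(n-1,\mathcal{F})-\pi(\mathcal{F})n\right|\leq \sigma n \quad\text{and}\quad \left|\lambda_{\alpha}(\mathcal{G}'_{n})-\frac{2\mathrm{ex}(n,\mathcal{F})}{n}\right|\leq \sigma.$$ Then there exists $n_{0}>0$ such that every $\mathcal{F}$-free graph $G$ on $n\geq n_0$ vertices satisfies $\lambda_{\alpha}(G)\leq \lambda_{\alpha}(\mathcal{G}'_{n})$; moreover, if equality holds then $G\in \mathcal{G}'_{n}$.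
   Context: $\lambda_\alpha(G)$ is the largest eigenvalue of $A_\alpha(G)=\alpha D(G)+(1-\alpha)A(G)$ ($A$ adjacency matrix, $D$ diagonal degree matrix). $\chi(\mathcal{F})=\min_{F\in\mathcal{F}}\chi(F)$. $\mathcal{F}$-free means containing no member of $\mathcal{F}$ as a subgraph. $\mathrm{ex}(n,\mathcal{F})$ is the maximum number of edges of an $\mathcal{F}$-free graph on $n$ vertices, and $\pi(\mathcal{F})=\lim_{n\to\infty}\mathrm{ex}(n,\mathcal{F})/\binom n2$ (which equals $1-\frac1r$ by the Erdős–Stone–Simonovits theorem). *)

(* Defs.v *)
From HB Require Import structures.
From mathcomp Require Import all_boot all_order all_algebra.
From mathcomp Require Import boolp classical_sets reals topology normedtype sequences.
Set Implicit Arguments. Unset Strict Implicit. Unset Printing Implicit Defensive.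
Import Order.TTheory GRing.Theory Num.Theory numFieldNormedType.Exports.
Local Open Scope ring_scope.

Record graph := Graph {
  gv : nat;
  gadj : 'I_gv -> 'I_gv -> bool;
  gadj_irr : forall u, ~~ gadj u u;
  gadj_sym : forall u v, gadj u v = gadj v u }.

Definition hgraph (n : nat) := {ffun 'I_n * 'I_n -> bool}.

Definition simpleb n (g : hgraph n) : bool :=
  [forall i, ~~ g (i, i)] && [forall i, forall j, g (i, j) == g (j, i)].

Definition nedges n (g : hgraph n) : nat :=
  #|[set e : 'I_n * 'I_n | g e && (val e.1 < val e.2)%N]|.

Definition deg n (g : hgraph n) (i : 'I_n) : nat := #|[set j | g (i, j)]|.

Definition contains (H : graph) n (g : hgraph n) : Prop :=
  exists f : 'I_(gv H) -> 'I_n, injective f /\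
    forall u v, @gadj H u v -> g (f u, f v).

Definition Ffree (F : graph -> Prop) n (g : hgraph n) : Prop :=
  forall H, F H -> ~ contains H g.

Definition colorable (H : graph) (k : nat) : Prop :=
  exists c : 'I_(gv H) -> 'I_k, forall u v, @gadj H u v -> c u != c v.

Definition has_chromatic_number (H : graph) (k : nat) : Prop :=
  colorable H k /\ forall j, colorable H j -> (k <= j)%N.

Definition family_chromatic (F : graph -> Prop) (k : nat) : Prop :=
  (exists H, F H /\ has_chromatic_number H k) /\
  forall H j, F H -> has_chromatic_number H j -> (k <= j)%N.

Definition ex (F : graph -> Prop) (n : nat) : nat :=
  \max_(g : hgraph n | simpleb g && `[< Ffree F g >]) nedges g.

Definition turan_density {R : realType} (F : graph -> Prop) : R :=
  limn (fun n : nat => (ex F n)%:R / ('C(n, 2))%:R : R).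

Definition Aalpha {R : realType} (alpha : R) n (g : hgraph n) : 'M[R]_n :=
  \matrix_(i, j) (alpha * (deg g i)%:R * (i == j)%:R + (1 - alpha) * (g (i, j))%:R).

(* lambda_alpha(G): largest eigenvalue of A_alpha(G) (a real symmetric matrix,
   so all its eigenvalues are real; the set below is finite). *)
Definition lambda_alpha {R : realType} (alpha : R) n (g : hgraph n) : R :=
  sup [set a : R | eigenvalue (Aalpha alpha g) a].

Definition inGprime {R : realType} (F : graph -> Prop) (eps : R) n (g : hgraph n) : Prop :=
  simpleb g /\ Ffree F g /\
  forall i : 'I_n, (turan_density F - eps) * n%:R < (deg g i)%:R.

(* lambda_alpha(G'_n) = max over H in G'_n (spectral radii are >= 0, so 0 is a
   neutral default; the hypotheses of the theorem concern n with G'_n used). *)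
Definition lambda_Gprime {R : realType} (F : graph -> Prop) (eps alpha : R) (n : nat) : R :=
  \big[Num.max/0]_(g : hgraph n | `[< inGprime F eps g >]) lambda_alpha alpha g.

(* Main.v *)
Require Import Defs.
From HB Require Import structures.
From mathcomp Require Import all_boot all_order all_algebra.
From mathcomp Require Import boolp classical_sets reals topology normedtype sequences.
From mathcomp Require Import derive.
From mathcomp Require Import ring lra zify.
Import Order.TTheory GRing.Theory Num.Theory numFieldNormedType.Exports.
Local Open Scope ring_scope.

(* Let x be the unit Perron vector of a graph G of order m, let w be its least
   entry and lam = lambda_alpha G.  Deleting w raises lam / (m - 1) by at least
   (lam / (m - 1) - alpha) (1 - m x_w^2) / (m - 2).  If some vertex u has degree at
   most (pi - eps) m, comparing the weights of the neighbours of u with x_u gives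
   2 (lam - deg u) x_w^2 <= 1 - m x_w^2, so 1 - m x_w^2 is bounded below by a
   multiple of eps, and lam / (m - 1) grows by at least (9 eps / 10)^2 / (m - 2).
   Since (9 eps / 10)^2 > 6 sigma, this outweighs the variation of the Turan
   density, so the smaller graph again lies above lambda_alpha(G'_(m-1)) and again
   has a vertex of small degree.  The divergence of the harmonic series contradicts
   the boundedness of lam / (m - 1) when the initial order is large. *)

(** * Quadratic forms and the top eigenvector of a symmetric matrix *)

Lemma quad_mxE (R : realType) n (A : 'M[R]_n) (x : 'rV[R]_n) :
  (x *m A *m x^T) 0 0 = \sum_i \sum_j A i j * x 0 i * x 0 j.
Proof.
rewrite mxE exchange_big /=; apply: eq_bigr => j _.
rewrite !mxE mulr_suml; apply: eq_bigr => i _; ring.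
Qed.

Lemma dot_mxE (R : realType) n (x : 'rV[R]_n) :
  (x *m x^T) 0 0 = \sum_i x 0 i ^+ 2.
Proof. by rewrite mxE; apply: eq_bigr => i _; rewrite mxE expr2. Qed.

Lemma continuous_sumr (R : realType) (T : topologicalType) (I : finType)
    (f : I -> T -> R) :
  (forall i, continuous (f i)) -> continuous (fun x => \sum_i f i x).
Proof. by move=> cf; apply: continuous_big => // z; exact: add_continuous. Qed.

(** The unit sphere is closed and bounded, hence compact, and the form is a polynomial in the
    coordinates. *)
Lemma quad_attains_max (R : realType) n (A : 'M[R]_n.+1) :
  exists x : 'rV[R]_n.+1, \sum_i x 0 i ^+ 2 = 1 /\
    forall y : 'rV[R]_n.+1, \sum_i y 0 i ^+ 2 = 1 ->
      (y *m A *m y^T) 0 0 <= (x *m A *m x^T) 0 0.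
Proof.
pose f (x : 'rV[R]_n.+1) := (x *m A *m x^T) 0 0.
pose g (x : 'rV[R]_n.+1) := \sum_i x 0 i ^+ 2.
pose S : set 'rV[R]_n.+1 := [set x | g x = 1]%classic.
have cc i : continuous (fun x : 'rV[R]_n.+1 => x 0 i) by exact: coord_continuous.
have cg : continuous g.
  apply: continuous_sumr => i x; exact: (cvgM (cc i x) (cc i x)).
have cf : continuous f.
  rewrite /f; under eq_fun do rewrite quad_mxE.
  apply: (@continuous_sumr _ _ _
    (fun i (x : 'rV[R]_n.+1) => \sum_j A i j * x 0 i * x 0 j)) => i.
  apply: (@continuous_sumr _ _ _
    (fun j (x : 'rV[R]_n.+1) => A i j * x 0 i * x 0 j)) => j x.
  exact: (cvgM (cvgM (cvg_cst (A i j)) (cc i x)) (cc j x)).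
have Sb i x : S x -> `|x 0 i| <= 1.
  rewrite /S /= /g => h; rewrite -(@expr_le1 _ 2) // real_normK ?num_real //.
  by rewrite -h (bigD1 i) //= lerDl sumr_ge0 // => j _; rewrite sqr_ge0.
have S0 : (S !=set0)%classic.
  exists (delta_mx 0 0); rewrite /S /g /= (bigD1 ord0) //= big1 ?addr0.
    by rewrite mxE !eqxx expr1n.
  by move=> i /negPf i0; rewrite mxE i0 expr0n.
have cS : compact S.
  apply: bounded_closed_compact.
    exists 1; split=> // M M1 x Sx /=.
    rewrite [`|x|]mx_normrE; apply: bigmax_le; first by apply: ltW; apply: lt_trans M1.
    by move=> [i j] _ /=; rewrite ord1; apply: le_trans (ltW M1); exact: Sb.
  have -> : S = (g @^-1` [set 1])%classic by [].
  by apply: closed_comp; [move=> x _; exact: cg|exact: closed_eq].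
have [x xS mx] := compact_EVT_max S0 cS (continuous_subspaceT cf).
exists x; split; first by move: xS; rewrite inE.
by move=> y yS; apply: mx; rewrite inE.
Qed.

Lemma dot_mx_ge0 (R : realType) n (x : 'rV[R]_n) : 0 <= (x *m x^T) 0 0.
Proof. by rewrite dot_mxE sumr_ge0 // => i _; rewrite sqr_ge0. Qed.

Lemma dot_mx_eq0 (R : realType) n (x : 'rV[R]_n) : (x *m x^T) 0 0 <= 0 -> x = 0.
Proof.
rewrite dot_mxE => h; apply/rowP => i; rewrite mxE; apply/eqP; rewrite -sqrf_eq0.
rewrite eq_le sqr_ge0 andbT; apply: le_trans h; rewrite (bigD1 i) //= lerDl.
by apply: sumr_ge0 => j _; rewrite sqr_ge0.
Qed.

Lemma linear_term_le0 (R : realFieldType) (N c : R) :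
  0 <= c -> (forall s, 0 <= - 2 * s * N + s ^+ 2 * c) -> N <= 0.
Proof.
move=> c0 h; have c1 : 0 < c + 1 by lra.
(* Shifting the optimal [N / c] to [N / (c + 1)] keeps the denominator positive when [c = 0]. *)
have := h (N / (c + 1)).
have -> : - 2 * (N / (c + 1)) * N + (N / (c + 1)) ^+ 2 * c =
  - (N ^+ 2 * (c + 2) / (c + 1) ^+ 2) by field; lra.
rewrite oppr_ge0 pmulr_lle0 ?invr_gt0 ?exprn_gt0 // pmulr_lle0; last by lra.
by move=> N2; rewrite leNgt; apply/negP => N0; nra.
Qed.

(** A zero of a nonnegative form is a minimum, so the first-order variation vanishes there. Moving
    from [x] to [x - s r] with [r = x B] changes the form by [- 2 s |r|^2 + s^2 c], which forces
    [r = 0]. *)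
Lemma psd_isotropic_ker (R : realType) n (B : 'M[R]_n) (x : 'rV[R]_n) :
  B^T = B -> (forall z : 'rV[R]_n, 0 <= (z *m B *m z^T) 0 0) ->
  (x *m B *m x^T) 0 0 = 0 -> x *m B = 0.
Proof.
move=> symB psd x0; apply: dot_mx_eq0; pose r := x *m B; rewrite -/r.
pose N : R := (r *m r^T) 0 0; pose c : R := (r *m B *m r^T) 0 0.
rewrite -/N.
have expand (s : R) : 0 <= - 2 * s * N + s ^+ 2 * c.
  have := psd (x - s *: r).
  have -> : (x - s *: r)^T = x^T - s *: r^T by rewrite linearB /= linearZ.
  rewrite mulmxBl -scalemxAl mulmxBl !mulmxBr -!scalemxAl -!scalemxAr.
  have -> : r *m B *m x^T = r *m r^T by rewrite [in RHS]/r trmx_mul symB mulmxA.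
  have -> : x *m B *m x^T = 0.
    by apply/matrixP => i j; rewrite !ord1 x0 mxE.
  suff -> : - 2 * s * N + s ^+ 2 * c =
      (0 - s *: (r *m r^T) - (s *: (r *m r^T) - s *: (s *: (r *m B *m r^T)))) 0 0.
    by rewrite /r.
  rewrite /N /c; move: (r *m r^T) (r *m B *m r^T) => P Q.
  by rewrite !mxE; ring.
exact: (linear_term_le0 _ _ _ (psd r) expand).
Qed.

(** Replacing the entries of a maximiser by their absolute values does not lower the form: only
    off-diagonal products change, and their coefficients are nonnegative. With [nu] the maximum,
    [nu - A] is positive semidefinite and vanishes at this vector, which is therefore an
    eigenvector. *)
Lemma sym_top_eigenpair (R : realType) n (A : 'M[R]_n.+1) :
  A^T = A -> (forall i j, i != j -> 0 <= A i j) ->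
  let mu := sup [set a : R | eigenvalue A a]%classic in
  (exists x : 'rV[R]_n.+1, [/\ forall i, 0 <= x 0 i, \sum_i x 0 i ^+ 2 = 1 &
      x *m A = mu *: x]) /\
  (forall y : 'rV[R]_n.+1,
    \sum_i \sum_j A i j * y 0 i * y 0 j <= mu * \sum_i y 0 i ^+ 2).
Proof.
move=> symA offA mu.
have [x0 [x0u x0max]] := quad_attains_max _ _ A.
pose x : 'rV[R]_n.+1 := \row_i `|x0 0 i|.
have xu : \sum_i x 0 i ^+ 2 = 1.
  by rewrite -x0u; apply: eq_bigr => i _; rewrite mxE real_normK ?num_real.
set nu : R := (x *m A *m x^T) 0 0.
have nuP : (x0 *m A *m x0^T) 0 0 <= nu.
  rewrite /nu !quad_mxE; apply: ler_sum => i _; apply: ler_sum => j _.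
  rewrite -!mulrA !mxE -normrM; have [->|ij] := eqVneq i j.
    by rewrite -expr2 normrX real_normK ?num_real.
  by rewrite ler_wpM2l ?offA // ler_norm.
have ray (y : 'rV[R]_n.+1) : (y *m A *m y^T) 0 0 <= nu * (y *m y^T) 0 0.
  have [y0|y0] := leP ((y *m y^T) 0 0) 0.
    by rewrite (dot_mx_eq0 _ _ _ y0) !mul0mx mxE mulr0.
  set N : R := (y *m y^T) 0 0 in y0 *.
  pose s := (Num.sqrt N)^-1.
  have s2 : s ^+ 2 = N^-1 by rewrite exprVn sqr_sqrtr // ltW.
  have zz : \sum_i (s *: y) 0 i ^+ 2 = 1.
    under eq_bigr do rewrite mxE exprMn.
    by rewrite -mulr_sumr -dot_mxE s2 mulVf // gt_eqF.
  have := le_trans (x0max _ zz) nuP.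
  have -> : ((s *: y) *m A *m (s *: y)^T) 0 0 = s ^+ 2 * (y *m A *m y^T) 0 0.
    by rewrite linearZ /= -!scalemxAl -scalemxAr scalerA mxE expr2.
  by rewrite s2 mulrC ler_pdivrMr.
have eig : x *m A = nu *: x.
  have : x *m (nu%:M - A) = 0.
    apply: psd_isotropic_ker.
    - by rewrite linearB /= tr_scalar_mx symA.
    - move=> z; rewrite mulmxBr mulmxBl mul_mx_scalar -scalemxAl.
      have := ray z; move: (z *m z^T) (z *m A *m z^T) => P Q.
      by rewrite !mxE subr_ge0.
    - rewrite mulmxBr mulmxBl mul_mx_scalar -scalemxAl.
      have -> : x *m A *m x^T = nu *: (x *m x^T).
        apply/matrixP => i j; rewrite !ord1 -/nu [RHS]mxE dot_mxE xu mulr1 //.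
      by rewrite subrr mxE.
  by rewrite mulmxBr mul_mx_scalar => /eqP; rewrite subr_eq0 => /eqP.
have x_neq0 : x != 0.
  apply/eqP => x_eq0; move: xu; rewrite x_eq0 big1 => [/esym/eqP|i _].
    by rewrite oner_eq0.
  by rewrite mxE expr0n.
have nu_eig : eigenvalue A nu by apply/eigenvalueP; exists x.
have nu_ub a : eigenvalue A a -> a <= nu.
  case/eigenvalueP => v vA v0; have := ray v; rewrite vA -scalemxAl.
  rewrite [X in X <= _]mxE ler_pM2r // lt_neqAle dot_mx_ge0 andbT eq_sym.
  by apply: contra v0 => /eqP h; apply/eqP/dot_mx_eq0; rewrite h.
have munu : mu = nu.
  apply/eqP; rewrite eq_le; apply/andP; split.
    by apply: ge_sup; [exists nu | move=> a; exact: nu_ub].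
  by apply: ub_le_sup => //; exists nu => a; exact: nu_ub.
rewrite munu; split.
  by exists x; split=> // i; rewrite mxE.
by move=> y; rewrite -quad_mxE -dot_mxE.
Qed.

(** * Perron vectors of [Aalpha] and vertex deletion *)

Section AlphaSpectral.
Context {R : realType} (alpha : R).
Hypotheses (alpha_ge0 : 0 <= alpha) (alpha_le1 : alpha <= 1).

Lemma simpleb_irr n (g : hgraph n) i : simpleb g -> g (i, i) = false.
Proof. by case/andP => /forallP h _; apply/negbTE/h. Qed.

Lemma simpleb_sym n (g : hgraph n) i j : simpleb g -> g (i, j) = g (j, i).
Proof. by case/andP => _ /forallP /(_ i) /forallP /(_ j) /eqP. Qed.

Lemma degE n (g : hgraph n) i : deg g i = (\sum_j g (i, j))%N.
Proof.
rewrite /deg -sum1_card [LHS]big_mkcond; apply: eq_bigr => j _.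
by rewrite inE; case: (g _).
Qed.

Lemma degRE n (g : hgraph n) i : (deg g i)%:R = \sum_j (g (i, j))%:R :> R.
Proof. by rewrite degE natr_sum. Qed.

(** The diagonal term of a vertex is spread over its edges, so that deleting a vertex just removes a
    row and a column of summands. *)
Lemma Aalpha_quadE n (g : hgraph n) (y : 'I_n -> R) :
  \sum_i \sum_j Aalpha alpha g i j * y i * y j =
  \sum_i \sum_j (g (i, j))%:R * (alpha * y i ^+ 2 + (1 - alpha) * (y i * y j)).
Proof.
apply: eq_bigr => i _.
under eq_bigr do rewrite mxE 2!mulrDl.
rewrite big_split /= (bigD1 i) //= eqxx big1 ?addr0; last first.
  by move=> j /negPf; rewrite eq_sym => ->; rewrite !(mulr0, mul0r).
under [RHS]eq_bigr do rewrite mulrDr.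
rewrite [RHS]big_split /= -mulr_suml -degRE; congr (_ + _); first by ring.
by apply: eq_bigr => j _; ring.
Qed.

Lemma lambda_alphaP n (g : hgraph n.+1) : simpleb g ->
  (exists x : 'I_n.+1 -> R, [/\ forall i, 0 <= x i, \sum_i x i ^+ 2 = 1 &
     forall i, \sum_j (g (i, j))%:R * (alpha * x i + (1 - alpha) * x j) =
       lambda_alpha alpha g * x i]) /\
  (forall y : 'I_n.+1 -> R,
    \sum_i \sum_j (g (i, j))%:R * (alpha * y i ^+ 2 + (1 - alpha) * (y i * y j))
      <= lambda_alpha alpha g * \sum_i y i ^+ 2).
Proof.
move=> sg; have symA : (Aalpha alpha g)^T = Aalpha alpha g.
  apply/matrixP => i j; rewrite !mxE (simpleb_sym _ _ j i sg).
  by have [->|ji] := eqVneq i j; rewrite ?eqxx // !mulr0.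
have offA i j : i != j -> 0 <= Aalpha alpha g i j.
  by move=> /negPf ij; rewrite mxE ij mulr0 add0r mulr_ge0 ?subr_ge0.
have [[x [x0 x1 eig]] ray] := sym_top_eigenpair _ _ _ symA offA.
split; last first.
  move=> y; rewrite -Aalpha_quadE; apply: etrans (ray (\row_i y i)).
  congr (_ <= _ * _); last by apply: eq_bigr => i _; rewrite mxE.
  by apply: eq_bigr => i _; apply: eq_bigr => j _; rewrite [in RHS]mxE [in RHS]mxE.
exists (fun i => x 0 i); split=> // i.
have /rowP /(_ i) := eig; rewrite !mxE => <-.
under [RHS]eq_bigr => j do rewrite mxE mulrDr eq_sym (simpleb_sym _ _ j i sg).
under [LHS]eq_bigr => j _ do rewrite mulrDr.
rewrite !big_split /= -mulr_suml -degRE [in RHS](bigD1 i) //= eqxx.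
rewrite [in X in _ = _ + X + _]big1 ?addr0; last first.
  by move=> j /negPf ji; rewrite eq_sym ji !mulr0.
by congr (_ + _); [rewrite mulr1; ring | apply: eq_bigr => j _; ring].
Qed.

Lemma lambda_alpha_le n (g : hgraph n.+1) : simpleb g ->
  lambda_alpha alpha g <= n.+1%:R.
Proof.
move=> sg; have [[x [x0 x1 eig]] _] := lambda_alphaP _ _ sg.
rewrite -[leLHS]mulr1 -[X in _ * X <= _]x1 mulr_sumr.
under eq_bigr do rewrite expr2 mulrA -eig mulr_suml.
have s2 : \sum_(i < n.+1) \sum_(j < n.+1) x i ^+ 2 = n.+1%:R.
  rewrite exchange_big /=; under eq_bigr => j _ do rewrite x1.
  by rewrite sumr_const card_ord.
have s2' : \sum_(i < n.+1) \sum_(j < n.+1) x j ^+ 2 = n.+1%:R.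
  by rewrite exchange_big.
(* The coefficients of [x i ^+ 2] and [x j ^+ 2] once the product is bounded by AM-GM; since
   [a + b = 1], the double sum equals the order. *)
pose a := alpha + (1 - alpha) / 2; pose b := (1 - alpha) / 2.
have -> : n.+1%:R = \sum_(i < n.+1) \sum_(j < n.+1) (a * x i ^+ 2 + b * x j ^+ 2).
  transitivity (a * n.+1%:R + b * n.+1%:R); first by rewrite /a /b; field.
  rewrite -{1}s2 -s2' [a * _]mulr_sumr [b * _]mulr_sumr -big_split /=.
  by apply: eq_bigr => i _; rewrite !mulr_sumr -big_split.
rewrite /a /b.
apply: ler_sum => i _; apply: ler_sum => j _.
have xx : x i * x j <= (x i ^+ 2 + x j ^+ 2) / 2.
  by have := sqr_ge0 (x i - x j); nra.
have ha : 0 <= 1 - alpha by rewrite subr_ge0.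
have h0 := mulr_ge0 alpha_ge0 (sqr_ge0 (x i)).
have h1 := ler_wpM2l ha xx.
have h2 := mulr_ge0 ha (mulr_ge0 (x0 i) (x0 j)).
by case: (g _); rewrite ?mul1r ?mul0r; nra.
Qed.

Definition delv {n} (g : hgraph n.+1) (w : 'I_n.+1) : hgraph n :=
  [ffun p => g (lift w p.1, lift w p.2)].

Lemma delvE n (g : hgraph n.+1) w i j :
  delv g w (i, j) = g (lift w i, lift w j).
Proof. by rewrite ffunE. Qed.

Lemma simpleb_delv n (g : hgraph n.+1) w : simpleb g -> simpleb (delv g w).
Proof.
move=> sg; apply/andP; split; apply/forallP => i.
  by rewrite delvE simpleb_irr.
by apply/forallP => j; rewrite !delvE simpleb_sym.
Qed.

Lemma Ffree_delv (F : graph -> Prop) n (g : hgraph n.+1) w :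
  Ffree F g -> Ffree F (delv g w).
Proof.
move=> Fg H FH [f [f_inj fE]]; apply: (Fg H FH); exists (lift w \o f); split.
  by apply: inj_comp f_inj; exact: lift_inj.
by move=> u v /fE; rewrite delvE.
Qed.

(* Deleting the vertex of smallest Perron weight: the diagonal contributions of
   its degree cancel, which leaves only the weight itself. *)
Lemma lambda_alpha_delv n (g : hgraph n.+2) (x : 'I_n.+2 -> R) w :
  simpleb g -> (forall i, 0 <= x i) -> \sum_i x i ^+ 2 = 1 ->
  (forall i, \sum_j (g (i, j))%:R * (alpha * x i + (1 - alpha) * x j) =
     lambda_alpha alpha g * x i) ->
  (forall i, x w <= x i) ->
  lambda_alpha alpha g * (1 - 2 * x w ^+ 2) - alpha * (1 - n.+2%:R * x w ^+ 2)
    <= lambda_alpha alpha (delv g w) * (1 - x w ^+ 2).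
Proof.
move=> sg x0 x1 eig xw; set lam := lambda_alpha alpha g.
pose E i j := (g (i, j))%:R * (alpha * x i ^+ 2 + (1 - alpha) * (x i * x j)).
have rowE i : \sum_j E i j = lam * x i ^+ 2.
  rewrite expr2 mulrA -eig mulr_suml; apply: eq_bigr => j _; rewrite /E; ring.
have totE : \sum_i \sum_j E i j = lam.
  by under eq_bigr do rewrite rowE; rewrite -mulr_sumr x1 mulr1.
have [_ ray] := lambda_alphaP _ _ (simpleb_delv _ _ w sg).
have := ray (fun i => x (lift w i)).
have -> : \sum_i x (lift w i) ^+ 2 = 1 - x w ^+ 2.
  by rewrite -x1 (bigD1_ord w) //= addrC addrK.
apply: le_trans.
under eq_bigr => i _ do under eq_bigr => j _ do rewrite delvE -/(E (lift w i) (lift w j)).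
have Eww : E w w = 0 by rewrite /E simpleb_irr // mul0r.
have splitE : lam = lam * x w ^+ 2 + (\sum_i E (lift w i) w +
    \sum_i \sum_j E (lift w i) (lift w j)).
  rewrite -{1}totE (bigD1_ord w) //= rowE -big_split /=; congr (_ + _).
  by apply: eq_bigr => i _; rewrite (bigD1_ord w).
have colE : \sum_i E (lift w i) w = \sum_i E i w.
  by rewrite [RHS](bigD1_ord w) //= Eww add0r.
(* The row and the column of [w] share the product terms, so their difference involves only the
   diagonal part. *)
have colw : \sum_i E i w - \sum_i E w i =
    alpha * \sum_i (g (w, i))%:R * (x i ^+ 2 - x w ^+ 2).
  rewrite -sumrB mulr_sumr; apply: eq_bigr => i _.
  by rewrite /E (simpleb_sym _ _ i w sg); ring.
(* By minimality of [x w] every summand is nonnegative, so the sum may be extended from the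
   neighbours of [w] to all vertices. *)
have colle : \sum_i (g (w, i))%:R * (x i ^+ 2 - x w ^+ 2) <= 1 - n.+2%:R * x w ^+ 2.
  have -> : n.+2%:R * x w ^+ 2 = \sum_(i < n.+2) x w ^+ 2.
    by rewrite sumr_const card_ord mulr_natl.
  rewrite -[X in _ <= X - _]x1 -sumrB; apply: ler_sum => i _.
  have h : 0 <= x i ^+ 2 - x w ^+ 2 by rewrite subr_ge0 ler_sqr ?nnegrE.
  by case: (g _); rewrite ?mul1r ?mul0r.
have := ler_wpM2l alpha_ge0 colle; rewrite -colw rowE -colE => h.
clear -splitE h; move: splitE h.
move: (\sum_i E (lift w i) w) (\sum_i \sum_j E (lift w i) (lift w j)) => P Q.
by clearbody lam; move=> splitE h; lra.
Qed.

(** The eigenvalue equation at [u] fixes the neighbour sum [P], and [amgm] then bounds the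
    neighbours' squared weight [S] from below by a multiple of [x u ^+ 2]. From above, [S] is at
    most 1 minus the weight of the non-neighbours, each of which has at least [x w ^+ 2]. *)
Lemma lambda_alpha_gap n (g : hgraph n.+1) (x : 'I_n.+1 -> R) (w u : 'I_n.+1) :
  (forall i, 0 <= x i) -> \sum_i x i ^+ 2 = 1 ->
  (forall i, \sum_j (g (i, j))%:R * (alpha * x i + (1 - alpha) * x j) =
     lambda_alpha alpha g * x i) ->
  (forall i, x w <= x i) -> (deg g u)%:R <= lambda_alpha alpha g ->
  2 * (lambda_alpha alpha g - (deg g u)%:R) * x w ^+ 2 <= 1 - n.+1%:R * x w ^+ 2.
Proof.
move=> x0 x1 eig xw dle; set lam := lambda_alpha alpha g in dle *.
set d : R := (deg g u)%:R in dle *.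
have xw2 i : x w ^+ 2 <= x i ^+ 2 by rewrite ler_sqr ?nnegrE.
pose S := \sum_j (g (u, j))%:R * x j ^+ 2.
pose P := \sum_j (g (u, j))%:R * x j.
have eigu : alpha * d * x u + (1 - alpha) * P = lam * x u.
  rewrite -eig /P /d degRE mulr_sumr mulr_suml mulr_sumr -big_split /=.
  by apply: eq_bigr => j _; ring.
(* AM-GM against the weight of [u] itself replaces Cauchy-Schwarz. *)
have amgm : 0 <= S - 2 * x u * P + d * x u ^+ 2.
  have -> : S - 2 * x u * P + d * x u ^+ 2 =
      \sum_j (g (u, j))%:R * (x j - x u) ^+ 2.
    rewrite /S /P /d degRE mulr_sumr mulr_suml -sumrB -big_split /=.
    by apply: eq_bigr => j _; ring.
  by apply: sumr_ge0 => j _; rewrite mulr_ge0 ?sqr_ge0.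
have Sle : S <= 1 - n.+1%:R * x w ^+ 2 + d * x w ^+ 2.
  have -> : n.+1%:R * x w ^+ 2 = \sum_(i < n.+1) x w ^+ 2.
    by rewrite sumr_const card_ord mulr_natl.
  rewrite -[X in _ <= X - _ + _]x1 /d degRE mulr_suml -sumrB -big_split /=.
  apply: ler_sum => j _; have h := xw2 j.
  by case: (g _); rewrite ?mul1r ?mul0r; lra.
have nw : 0 <= 1 - n.+1%:R * x w ^+ 2.
  rewrite -[X in _ <= X - _]x1 mulr_natl -[X in _ *+ X]card_ord -sumr_const -sumrB.
  by apply: sumr_ge0 => j _; rewrite subr_ge0.
have d0 : 0 <= d by rewrite ler0n.
have k1 : 0 <= (1 - alpha) * (S - 2 * x u * P + d * x u ^+ 2).
  by rewrite mulr_ge0 ?subr_ge0.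
have k2 : (1 - alpha) * S <= (1 - alpha) * (1 - n.+1%:R * x w ^+ 2 + d * x w ^+ 2).
  by rewrite ler_wpM2l ?subr_ge0.
have k3 : (2 * (lam - d) + (1 - alpha) * d) * x w ^+ 2 <=
    (2 * (lam - d) + (1 - alpha) * d) * x u ^+ 2.
  by rewrite ler_wpM2l // addr_ge0 ?mulr_ge0 ?subr_ge0.
have k4 : 0 <= alpha * (1 - n.+1%:R * x w ^+ 2) by rewrite mulr_ge0.
have eigu2 : (1 - alpha) * (2 * x u * P) = 2 * (lam - alpha * d) * x u ^+ 2.
  have e : (1 - alpha) * P = lam * x u - alpha * d * x u.
    by rewrite -eigu [X in _ = X - _]addrC addrK.
  by transitivity (2 * x u * ((1 - alpha) * P)); [ring | rewrite e; ring].
clear -k1 k2 k3 k4 eigu2.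
nra.
Qed.

End AlphaSpectral.

(** * Edge counts and extremal numbers *)

Lemma handshake n (g : hgraph n) : simpleb g ->
  (\sum_i deg g i)%N = (2 * nedges g)%N.
Proof.
move=> sg; rewrite mul2n -addnn /nedges -sum1_card.
under eq_bigr do rewrite degE.
rewrite pair_big /= big_mkcond.
have -> : (\sum_(p : 'I_n * 'I_n) g (p.1, p.2))%N =
    (\sum_(p : 'I_n * 'I_n) ((g p && (p.1 < p.2)) + (g p && (p.2 < p.1))))%N.
  apply: eq_bigr => -[i j] _ /=; case: (ltngtP i j); rewrite ?andbT ?andbF ?addn0 //.
  by move/val_inj->; rewrite simpleb_irr.
rewrite big_split /=; congr (_ + _)%N.
  by rewrite [RHS]big_mkcond; apply: eq_bigr => p _; rewrite inE; case: (_ && _).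
rewrite (reindex_inj (h := fun p : 'I_n * 'I_n => (p.2, p.1))) /=; last first.
  by move=> [a b] [c d] [-> ->].
rewrite [RHS]big_mkcond; apply: eq_bigr => -[i j] _; rewrite inE /=.
by rewrite (simpleb_sym _ _ j i sg); case: (_ && _).
Qed.

Lemma deg_delv n (g : hgraph n.+1) w i : simpleb g ->
  (deg (delv g w) i + g (w, lift w i))%N = deg g (lift w i).
Proof.
move=> sg; rewrite !degE (bigD1_ord w) //= addnC (simpleb_sym _ _ w) //.
by congr (_ + _)%N; apply: eq_bigr => j _; rewrite delvE.
Qed.

Lemma nedges_delv n (g : hgraph n.+1) w : simpleb g ->
  nedges g = (nedges (delv g w) + deg g w)%N.
Proof.
move=> sg; apply/eqP; rewrite -(eqn_pmul2l (isT : (0 < 2)%N)) mulnDr; apply/eqP.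
rewrite -!handshake ?simpleb_delv // (bigD1_ord w) //=.
under eq_bigr do rewrite -deg_delv //.
rewrite big_split /= addnCA mul2n -addnn; congr (_ + (_ + _))%N.
by rewrite [RHS]degE (bigD1_ord w) //= simpleb_irr.
Qed.

Section Extremal.
Context (F : graph -> Prop).

Lemma nedges_le_ex n (g : hgraph n) : simpleb g -> Ffree F g ->
  (nedges g <= ex F n)%N.
Proof. by move=> sg Fg; apply: leq_bigmax_cond; rewrite sg; apply/asboolP. Qed.

Lemma mul_ex_le n a b :
  (forall g : hgraph n, simpleb g -> Ffree F g -> a * nedges g <= b)%N ->
  (a * ex F n <= b)%N.
Proof.
move=> h; rewrite /ex; apply: (big_ind (fun m => a * m <= b)%N).
- by rewrite muln0.
- by move=> m p mb pb; rewrite maxnMr geq_max mb.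
- by move=> g /andP[sg /asboolP Fg]; exact: h.
Qed.

(** Averaging over all vertex deletions: each edge survives all but two of the [n.+2] deletions. *)
Lemma ex_katona n : (n * ex F n.+2 <= n.+2 * ex F n.+1)%N.
Proof.
apply: mul_ex_le => g sg Fg.
have : (\sum_(w < n.+2) nedges (delv g w) <= \sum_(w < n.+2) ex F n.+1)%N.
  by apply: leq_sum => w _; apply: nedges_le_ex; [exact: simpleb_delv|exact: Ffree_delv].
rewrite sum_nat_const card_ord; apply: leq_trans.
rewrite -(leq_add2r (\sum_i deg g i)) -big_split /=.
under [X in (_ <= X)%N]eq_bigr do rewrite -nedges_delv //.
by rewrite sum_nat_const card_ord handshake // -mulnDl addn2.
Qed.

Lemma ex_le_sq n : (2 * ex F n <= n * n)%N.
Proof.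
apply: mul_ex_le => g sg _; rewrite -handshake //.
rewrite -[X in (_ <= X * _)%N]card_ord -sum_nat_const; apply: leq_sum => i _.
by rewrite -[X in (_ <= X)%N]card_ord; exact: max_card.
Qed.

Lemma colorable_chromatic H r : colorable H r ->
  exists2 j, (j <= r)%N & has_chromatic_number H j.
Proof.
move=> Hr; have ex_col : exists j, `[< colorable H j >] by exists r; exact/asboolP.
exists (ex_minn ex_col); case: ex_minnP => j /asboolP Hj jmin.
  by apply: jmin; exact/asboolP.
by split=> // i /asboolP; exact: jmin.
Qed.

Lemma Ffree_of_coloring r n (g : hgraph n) (c : 'I_n -> 'I_r) :
  family_chromatic F r.+1 -> (forall i j, g (i, j) -> c i != c j) -> Ffree F g.
Proof.
move=> [_ Fmin] gc H FH [f [_ fE]].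
have [|j jr Hj] := colorable_chromatic H r.
  by exists (c \o f) => u v /fE /gc.
by have := leq_trans (Fmin _ _ FH Hj) jr; rewrite ltnn.
Qed.

Definition turan_graph n r : hgraph n :=
  [ffun p : 'I_n * 'I_n => (p.1 %% r != p.2 %% r)%N].

(** The quotient by [r] is injective on a residue class and takes values below [k]. *)
Lemma card_residue_class k r c : (0 < r)%N ->
  (#|[set j : 'I_(k * r) | (j %% r)%N == c]| <= k)%N.
Proof.
move=> r0; pose h (j : 'I_(k * r)) : 'I_k :=
  Ordinal (eq_ind_r is_true (ltn_ord j) (ltn_divLR j k r0)).
rewrite -(@card_in_imset _ _ h) => [|i j].
  by rewrite -[X in (_ <= X)%N]card_ord max_card.
rewrite !inE => /eqP ic /eqP jc /(congr1 val) /= ij; apply: val_inj => /=.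
by rewrite (divn_eq i r) (divn_eq j r) ij ic jc.
Qed.

(** At order [k * r] each part has at most [k] vertices, so every degree of the Turan graph is at
    least [k * r - k]. *)
Lemma ex_turan_ge k r : (0 < r)%N -> family_chromatic F r.+1 ->
  (k * r * (k * r - k) <= 2 * ex F (k * r))%N.
Proof.
move=> r0 Fr; set n := (k * r)%N; pose g := turan_graph n r.
have sg : simpleb g.
  apply/andP; split; apply/forallP => i; first by rewrite ffunE eqxx.
  by apply/forallP => j; rewrite !ffunE /= [X in ~~ X == _]eq_sym.
have Fg : Ffree F g.
  apply: (@Ffree_of_coloring r _ _ (fun i => Ordinal (ltn_pmod i r0))) => // i j.
  by rewrite ffunE; apply: contra => /eqP [->].
apply: leq_trans (_ : 2 * nedges g <= _)%N; last by rewrite leq_mul2l nedges_le_ex.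
rewrite -handshake // -[X in (X * _ <= _)%N]card_ord -sum_nat_const.
apply: leq_sum => i _; rewrite leq_subLR -[X in (X <= _)%N]card_ord.
rewrite -(cardsC [set j : 'I_n | (j %% r == i %% r)%N]) leq_add ?card_residue_class //.
rewrite /deg; apply: subset_leq_card; apply/fintype.subsetP => j; rewrite !inE ffunE /=.
by rewrite eq_sym.
Qed.

End Extremal.

(** * Monotonicity and bounds for the Turan density *)

Section Density.
Context {R : realType} (F : graph -> Prop).

Definition ex_density (n : nat) : R := (ex F n)%:R / ('C(n, 2))%:R.

(** From order 2 on the binomial coefficient is nonzero, whence the shift by two here and below. *)
Lemma ex_densityE n : ex_density n.+2 = 2 * (ex F n.+2)%:R / (n.+2%:R * n.+1%:R).
Proof.
have h : 'C(n.+2, 2)%:R = n.+2%:R * n.+1%:R / 2 :> R.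
  have := mul_bin_diag n.+2 1; rewrite bin1 => h.
  by rewrite -natrM /= h natrM mulrC mulKf // pnatr_eq0.
by rewrite /ex_density h invf_div mulrA [_ * 2]mulrC.
Qed.

Lemma ex_density_nonincreasing :
  {homo (fun n => ex_density n.+2) : m n / (m <= n)%N >-> n <= m}.
Proof.
apply: homo_leq => // [a b c ab bc|n]; first exact: le_trans bc ab.
rewrite !ex_densityE.
have h : n.+1%:R * (ex F n.+3)%:R <= n.+3%:R * (ex F n.+2)%:R :> R.
  by rewrite -!natrM ler_nat ex_katona.
have n1 : 0 < n.+1%:R :> R by rewrite ltr0n.
have n2 : 0 < n.+2%:R :> R by rewrite ltr0n.
have n3 : 0 < n.+3%:R :> R by rewrite ltr0n.
move: h n1 n2 n3; move: (ex F n.+3)%:R (ex F n.+2)%:R n.+1%:R n.+2%:R n.+3%:R.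
move=> a b x y z h x0 y0 z0.
rewrite ler_pdivrMr ?mulr_gt0 //.
have -> : 2 * b / (y * x) * (z * y) = 2 * (z * b) / x by field; rewrite !gt_eqF.
by rewrite ler_pdivlMr //; lra.
Qed.

Lemma ex_density_cvg :
  (ex_density n @[n --> \oo] --> turan_density F)%classic.
Proof.
have c : cvgn (fun n => ex_density (n + 2)).
  apply: nonincreasing_is_cvgn.
    by move=> m n mn; rewrite !addn2; exact: ex_density_nonincreasing.
  by exists 0 => _ [n _ <-]; rewrite divr_ge0.
have h : (ex_density n @[n --> \oo] --> limn (fun n => ex_density (n + 2)))%classic.
  by rewrite -(cvg_shiftn 2).
by apply: cvgP h.
Qed.

Lemma turan_density_le n : turan_density F <= ex_density n.+2.
Proof.
have h : (ex_density (n + 2) @[n --> \oo] --> turan_density F)%classic.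
  by rewrite (cvg_shiftn 2); exact: ex_density_cvg.
rewrite -(cvg_lim (@Rhausdorff R) h) -[n.+2]addn2.
apply: (@nonincreasing_cvgn_ge _ (fun n => ex_density (n + 2)) _ _ n).
  by move=> i j ij; rewrite !addn2; exact: ex_density_nonincreasing.
by apply: cvgP h.
Qed.

Lemma ex_density_le_near tau : 0 < tau ->
  exists N : nat, forall n, (N <= n)%N -> ex_density n <= turan_density F + tau.
Proof.
move=> tau0; have /cvgrPdist_le /(_ _ tau0) [N _ h] := ex_density_cvg.
exists N => n Nn; have := h n Nn; rewrite /= ler_norml; lra.
Qed.

Lemma turan_density_le2 : turan_density F <= 2 :> R.
Proof.
apply: le_trans (turan_density_le 0) _; rewrite /ex_density divr1 (ler_nat _ _ 2).
by have := ex_le_sq F 2; lia.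
Qed.

Lemma turan_density_ge r : (1 < r)%N -> family_chromatic F r.+1 ->
  1 - 1 / r%:R <= turan_density F :> R.
Proof.
move=> r1 Fr; have r0 := ltnW r1.
apply: (cvgr_to_ge ex_density_cvg); exists 2 => // -[|[|n]] //= _.
(* By monotonicity the density at [n.+2] is at least the one at the multiple [m] of [r], where the
   balanced Turan graph applies. *)
pose m := (n.+2 * r)%N; have m2 : (2 <= m)%N by rewrite /m; nia.
have nm : (n <= m - 2)%N by rewrite /m; nia.
apply: (le_trans _ (ex_density_nonincreasing _ _ nm)).
have mE : (m - 2).+2 = m by lia.
rewrite ex_densityE mE.
have := @ex_turan_ge F n.+2 r r0 Fr; rewrite -/m => h.
have rR : 0 < r%:R :> R by rewrite ltr0n.
have hR : m%:R * (m%:R - n.+2%:R) <= 2 * (ex F m)%:R :> R.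
  rewrite -natrB; last by rewrite /m; nia.
  by rewrite -!natrM ler_nat.
rewrite ler_pdivlMr; last by rewrite mulr_gt0 ?ltr0n; lia.
apply: le_trans hR.
have -> : n.+2%:R = m%:R / r%:R :> R by rewrite /m natrM mulfK // gt_eqF.
have s1 : (m - 2).+1%:R = m%:R - 1 :> R.
  have -> : (m - 2).+1 = (m - 1)%N by lia.
  by rewrite natrB // ltnW.
have m1 : 1 <= m%:R :> R by rewrite ler1n; lia.
rewrite s1 mulrCA ler_wpM2l //.
have ri : r%:R^-1 <= 1 :> R by rewrite invf_le1 ?ler1n.
have ri0 : 0 <= r%:R^-1 :> R by rewrite invr_ge0.
rewrite div1r; nra.
Qed.

End Density.

(** * Numerical inequalities for one deletion *)

(* Here [m] is the order of the graph, [lam] and [lam'] are the spectral radii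
   before and after the deletion of a vertex whose squared weight is [xi], [d] is
   the small degree, [e] is [ex m] and [pi] is the Turan density. *)
Lemma density_increment (R : realFieldType) (m lam lam' xi d pi eps sigma alpha e : R) :
  3 <= m -> 0 < eps -> eps < 1 / 2 -> 0 <= xi ->
  lam * (1 - 2 * xi) - alpha * (1 - m * xi) <= lam' * (1 - xi) ->
  2 * (lam - d) * xi <= 1 - m * xi ->
  d <= (pi - eps) * m -> alpha <= pi - eps ->
  2 * e / m - sigma <= lam -> pi <= 2 * e / (m * (m - 1)) ->
  sigma + pi <= eps / 10 * m -> sigma <= eps / 10 * (m - 1) ->
  lam / (m - 1) * (m - 2) + (9 / 10 * eps) ^+ 2 <= lam'.
Proof.
move=> m3 e0 e2 xi0 A B dle ale lamge pile s1 s2.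
have m0 : 0 < m by lra.
have m1 : 0 < m - 1 by lra.
set l := lam / (m - 1).
have lamE : lam = l * (m - 1) by rewrite /l divfK // gt_eqF.
have lam_ge : pi * (m - 1) - sigma <= lam.
  apply: le_trans lamge; rewrite lerD2r.
  by move: pile; rewrite ler_pdivlMr ?mulr_gt0 // ler_pdivlMr //; nra.
(* A tenth of [eps] absorbs [sigma] and the lower-order terms; the remaining [9 / 10 * eps] bounds
   [l - alpha], [(lam - d) / m] and, further on, [1 - t] from below. *)
have l_ge : pi - eps / 10 <= l.
  by rewrite /l ler_pdivlMr //; nra.
have lamd : 9 / 10 * eps * m <= lam - d by nra.
set t := m * xi in A B *.
have t0 : 0 <= t by rewrite mulr_ge0 // ltW.
have Bt : 2 * (9 / 10 * eps) * t <= 1 - t.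
  apply: le_trans B; rewrite /t -!mulrA ler_wpM2l // !mulrA ler_wpM2r //; lra.
(* With [c = 9 / 10 * eps], [Bt] gives [1 - t >= 2 c / (1 + 2 c)], which is at least [c] because
   [2 c <= 1]. *)
have t1 : 9 / 10 * eps <= 1 - t by nra.
have gain : (9 / 10 * eps) ^+ 2 <= (l - alpha) * (1 - t).
  by rewrite expr2; apply: ler_pM; lra.
have xi1 : 0 < 1 - xi by rewrite /t in t1; nra.
rewrite -(ler_pM2r xi1); apply: le_trans A; rewrite lamE.
have -> : l * (m - 1) * (1 - 2 * xi) - alpha * (1 - t) =
  l * (m - 2) * (1 - xi) + (l - alpha) * (1 - t) by rewrite /t; ring.
rewrite mulrDl lerD2l; apply: le_trans gain.
have := sqr_ge0 (9 / 10 * eps); nra.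
Qed.

(* [e'] is [ex (m - 1)], and [2 e' / (m - 1) + sigma] bounds [lambda_Gprime] at
   order [m - 1] from above. *)
Lemma turan_increment (R : realFieldType) (m lam pi eps sigma e e' : R) :
  3 <= m -> 0 < eps -> eps < 1 / 2 -> 0 < sigma -> sigma < eps ^+ 3 / 7 -> 0 <= pi ->
  2 * e / m - sigma <= lam ->
  (pi - sigma) * m <= e - e' -> 2 * e' / ((m - 1) * (m - 2)) <= pi + sigma ->
  2 * e' / (m - 1) + sigma < lam / (m - 1) * (m - 2) + (9 / 10 * eps) ^+ 2.
Proof.
move=> m3 e0 e2 s0 s7 pi0 lamge inc e'le.
have m0 : 0 < m by lra.
have m1 : 0 < m - 1 by lra.
have m2 : 0 < m - 2 by lra.
(* The six copies of [sigma] are four from [k'], one from [lamge] and one from the bound on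
   [lambda_Gprime]. *)
have c6 : 6 * sigma < (9 / 10 * eps) ^+ 2.
  have : 6 * sigma < 6 * (eps ^+ 3 / 7) by lra.
  move/lt_le_trans; apply; rewrite !exprS expr0 !mulr1; nra.
rewrite ler_pdivrMr ?mulr_gt0 // in e'le.
(* The left side is [4 e' - 2 (e - e') (m - 2)]; after both bounds are inserted the terms in [pi]
   add up to [- 2 pi (m - 2) <= 0], and only multiples of [sigma] remain. *)
have k : 2 * e' * m - 2 * e * (m - 2) <= 4 * sigma * (m * (m - 1)).
  have h1 : 2 * (pi - sigma) * m * (m - 2) <= 2 * (e - e') * (m - 2).
    by rewrite ler_wpM2r; lra.
  have h2 : 0 <= pi * (m - 2) by nra.
  have h3 : 0 <= sigma * (m - 2) by nra.
  have h4 : 0 <= sigma * m by nra.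
  nra.
have k' : 2 * e' / (m - 1) <= 2 * e / m / (m - 1) * (m - 2) + 4 * sigma.
  have mm : 0 < m * (m - 1) by rewrite mulr_gt0.
  rewrite -(ler_pM2r mm).
  have -> : 2 * e' / (m - 1) * (m * (m - 1)) = 2 * e' * m by field; rewrite gt_eqF.
  have -> : (2 * e / m / (m - 1) * (m - 2) + 4 * sigma) * (m * (m - 1)) =
     2 * e * (m - 2) + 4 * sigma * (m * (m - 1)) by field; rewrite !gt_eqF.
  by lra.
have k2 : (2 * e / m - sigma) / (m - 1) * (m - 2) <= lam / (m - 1) * (m - 2).
  by rewrite ler_wpM2r ?ler_wpM2r ?invr_ge0 // ltW.
have k3 : sigma / (m - 1) * (m - 2) <= sigma.
  by rewrite -mulrA ler_piMr ?(ltW s0) // mulrC ler_pdivrMr //; lra.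
move: k2; rewrite !mulrBl => k2; lra.
Qed.

Lemma harmonic_unbounded (R : realType) (B : R) :
  exists n0 : nat, forall n, (n0 <= n)%N -> B < series (@harmonic R) n.
Proof.
have nd : {homo series (@harmonic R) : m n / (m <= n)%N >-> m <= n}.
  by apply: nondecreasing_series => n _ _; exact: harmonic_ge0.
have [[n0 hn0]|h] := pselect (exists n0, B < series (@harmonic R) n0).
  by exists n0 => n /nd; exact: lt_le_trans.
exfalso; apply: (@dvg_harmonic R); apply: nondecreasing_is_cvgn => //.
exists B => _ [n _ <-]; rewrite leNgt; apply/negP => Bn; apply: h; by exists n.
Qed.

Lemma large_order_bounds (R : realFieldType) (m pi eps sigma : R) :
  pi <= 2 -> 0 < eps -> 10 * (3 + sigma) <= eps * (m - 1) ->
  sigma + pi <= eps / 10 * m /\ sigma <= eps / 10 * (m - 1).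
Proof. by move=> pi2 e0 h; split; lra. Qed.

(** Supplies the degree hypothesis of [lambda_alpha_gap]: the gap [eps * m] outweighs
    [sigma + pi]. *)
Lemma turan_degree_le (R : realFieldType) (m lam d pi eps sigma e : R) :
  3 <= m -> 0 < eps -> d <= (pi - eps) * m -> 2 * e / m - sigma <= lam ->
  pi <= 2 * e / (m * (m - 1)) -> sigma + pi <= eps / 10 * m -> d <= lam.
Proof.
move=> m3 e0 dle lamge pile s1.
have m0 : 0 < m by lra.
have m1 : 0 < m - 1 by lra.
apply: le_trans dle _; apply: le_trans lamge.
have : pi * (m - 1) <= 2 * e / m.
  by move: pile; rewrite ler_pdivlMr ?mulr_gt0 // ler_pdivlMr //; nra.
by move=> h; nra.
Qed.

(** * Descent through exceptional graphs *)

Section Descent.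
Context {R : realType} (F : graph -> Prop) (eps sigma alpha : R).
Notation pi := (turan_density F : R).
Notation lam := (lambda_alpha alpha).
Hypotheses (eps_gt0 : 0 < eps) (eps_lt : eps < 1 / 2).
Hypotheses (sigma_gt0 : 0 < sigma) (sigma_lt : sigma < eps ^+ 3 / 7).
Hypotheses (alpha_ge0 : 0 <= alpha) (alpha_le : alpha <= pi - eps).
Hypotheses (alpha_le1 : alpha <= 1) (pi_ge0 : 0 <= pi) (pi_le2 : pi <= 2).

Lemma lambda_alpha_le_Gprime n (g : hgraph n) :
  inGprime F eps g -> lam g <= lambda_Gprime F eps alpha n.
Proof.
move=> gG; rewrite /lambda_Gprime.
by apply: (le_bigmax_cond 0 (fun g => lam g)); apply/asboolP.
Qed.

(* The slack [sigma] lets the definition cover both the initial graph, which only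
   reaches [lambda_Gprime], and the graphs obtained from it by deletion. *)
Definition exceptional {n} (g : hgraph n) : Prop :=
  [/\ simpleb g, Ffree F g, ~ inGprime F eps g &
      2 * (ex F n)%:R / n%:R - sigma <= lam g].

Context (M : nat).
Hypothesis M_large : 10 * (3 + sigma) / eps <= M%:R.
Hypothesis ex_increment : forall n, (M <= n)%N ->
  `|(ex F n)%:R - (ex F n.-1)%:R - pi * n%:R| <= sigma * n%:R.
Hypothesis lambda_Gprime_near : forall n, (M <= n)%N ->
  `|lambda_Gprime F eps alpha n - 2 * (ex F n)%:R / n%:R| <= sigma.
Hypothesis ex_density_near : forall n, (M <= n)%N -> ex_density F n <= pi + sigma.

Lemma exceptional_low_degree n (g : hgraph n) : exceptional g ->
  exists u, (deg g u)%:R <= (pi - eps) * n%:R.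
Proof.
move=> [sg Fg nG _]; apply: contrapT => h; apply: nG; split=> //; split=> // u.
by rewrite ltNge; apply/negP => hu; apply: h; exists u.
Qed.

Lemma exceptional_descent k (g : hgraph k.+3) : (M <= k.+2)%N -> exceptional g ->
  exists g' : hgraph k.+2, exceptional g' /\
    lam g / k.+2%:R + (9 / 10 * eps) ^+ 2 / k.+1%:R <= lam g' / k.+1%:R.
Proof.
move=> Mk bg; have [u du] := exceptional_low_degree _ _ bg.
have [sg Fg nG lamge] := bg.
have [[x [x0 x1 eig]] _] := lambda_alphaP _ alpha_le1 _ _ sg.
have [w _ wmin] := arg_minP x (isT : xpredT (ord0 : 'I_k.+3)).
have xw i : x w <= x i by exact: wmin.
set m : R := k.+3%:R.
have mE1 : k.+2%:R = m - 1 :> R by rewrite /m -[k.+3]addn1 natrD addrK.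
have mE2 : k.+1%:R = m - 2 :> R by rewrite /m -[k.+3]addn2 natrD addrK.
have m3 : 3 <= m by rewrite /m (ler_nat _ 3).
have Mm : 10 * (3 + sigma) <= eps * (m - 1).
  have : M%:R <= m - 1 :> R by rewrite -mE1 ler_nat.
  by move/(le_trans M_large); rewrite ler_pdivrMr // [_ * eps]mulrC.
have [s1 s2] := large_order_bounds _ _ _ _ _ pi_le2 eps_gt0 Mm.
have A := lambda_alpha_delv _ alpha_ge0 alpha_le1 _ _ _ w sg x0 x1 eig xw.
have pile : pi <= 2 * (ex F k.+3)%:R / (m * (m - 1)).
  by rewrite -mE1 -ex_densityE; exact: turan_density_le.
have dle := turan_degree_le _ _ _ _ _ _ _ _ m3 eps_gt0 du lamge pile s1.
have B := lambda_alpha_gap _ alpha_ge0 alpha_le1 _ _ _ w u x0 x1 eig xw dle.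
have inc := density_increment _ _ _ _ _ _ _ _ _ _ _ m3 eps_gt0 eps_lt
  (sqr_ge0 _) A B du alpha_le lamge pile s1 s2.
have e1 : (pi - sigma) * m <= (ex F k.+3)%:R - (ex F k.+2)%:R.
  have := ex_increment _ (leqW Mk); rewrite /= ler_norml => /andP[h _].
  by rewrite -/m in h; nra.
have e2 : 2 * (ex F k.+2)%:R / ((m - 1) * (m - 2)) <= pi + sigma.
  by rewrite -mE1 -mE2 -ex_densityE; exact: ex_density_near.
have := turan_increment _ _ _ _ _ _ _ _ m3 eps_gt0 eps_lt sigma_gt0 sigma_lt pi_ge0
  lamge e1 e2 => inc'.
exists (delv g w); split.
  have big := lt_le_trans inc' inc.
  split; [exact: simpleb_delv|exact: Ffree_delv| |].
    (* Membership in the class would cap the new spectral radius at [2 e' / (m - 1) + sigma], which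
       [big] strictly exceeds. *)
    move=> /lambda_alpha_le_Gprime; apply/negP; rewrite -ltNge; apply: le_lt_trans big.
    have := lambda_Gprime_near _ Mk; rewrite ler_norml mE1 => /andP[_]; lra.
  rewrite mE1; apply: ltW; apply: le_lt_trans big; rewrite lerD2l.
  by apply: (@le_trans _ _ 0); rewrite ?oppr_le0 ltW.
have m2 : 0 < k.+1%:R :> R by rewrite ltr0n.
rewrite -(ler_pM2r m2) mulrDl !divfK ?gt_eqF //.
by rewrite mE1 mE2.
Qed.

(** The increments of [exceptional_descent] telescope into harmonic partial sums. Once the order is
    too small for a further deletion, the harmonic difference is nonpositive and the trivial bound
    [(k + 2) / (k + 1) <= 2] suffices. *)
Lemma exceptional_lambda_bound k (g : hgraph k.+2) : exceptional g ->
  lam g / k.+1%:R + (9 / 10 * eps) ^+ 2 *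
    (series (@harmonic R) k - series (@harmonic R) M) <= 2.
Proof.
have c0 : 0 <= (9 / 10 * eps) ^+ 2 by exact: sqr_ge0.
have nd : {homo series (@harmonic R) : m n / (m <= n)%N >-> m <= n}.
  by apply: nondecreasing_series => n _ _; exact: harmonic_ge0.
elim: k g => [|k IH] g bg; have [sg _ _ _] := bg.
  have le2 := lambda_alpha_le _ alpha_ge0 alpha_le1 _ _ sg.
  have := ler_wpM2l c0 (nd _ _ (leq0n M)); rewrite divr1; lra.
have [kM|Mk] := leqP k.+1 M.
  have le2 : lam g / k.+2%:R <= 2.
    rewrite ler_pdivrMr ?ltr0n //.
    apply: le_trans (lambda_alpha_le _ alpha_ge0 alpha_le1 _ _ sg) _.
    by rewrite -natrM ler_nat; clear; lia.
  rewrite -[leRHS]addr0 lerD // mulr_ge0_le0 // subr_le0; exact: nd.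
have [g' [bg' gg']] := exceptional_descent _ _ (leqW (ltnW Mk)) bg.
apply: le_trans (IH g' bg').
have -> : series (@harmonic R) k.+1 = series (@harmonic R) k + k.+1%:R^-1.
  by rewrite /series /= big_nat_recr.
by rewrite addrAC mulrDr [_ + _ / _]addrC addrA lerD2r.
Qed.

Lemma exceptional_bounded_order :
  exists n0 : nat, forall n (g : hgraph n), (n0 <= n)%N -> ~ exceptional g.
Proof.
have c0 : 0 < (9 / 10 * eps) ^+ 2 by rewrite exprn_gt0 ?mulr_gt0 ?invr_gt0 ?ltr0n.
(* The normalised spectral radius lies between [- sigma] and 2, so its total increase cannot exceed
   [2 + sigma]. *)
have [n0 hn0] := harmonic_unbounded R
  (series (@harmonic R) M + (2 + sigma) / (9 / 10 * eps) ^+ 2).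
exists n0.+2 => -[|[|k]] // g kn bg.
have := exceptional_lambda_bound _ _ bg.
have := hn0 k kn; rewrite -ltrBrDl ltr_pdivrMr // => h1 h2.
have [_ _ _ lamge] := bg.
have low : - sigma <= lam g / k.+1%:R.
  rewrite ler_pdivlMr ?ltr0n //; apply: le_trans lamge; rewrite addrC ler_wpDr //.
    by rewrite divr_ge0 ?mulr_ge0.
  by rewrite mulNr lerN2 ler_peMr ?(ltW sigma_gt0) // ler1n.
move: h1; rewrite ltNge => /negP; apply.
rewrite -lerBlDr mulrC; apply: le_trans h2; by rewrite addrC lerD2r.
Qed.

End Descent.

Theorem theorem5p1 (R : realType) (F : graph -> Prop) (r : nat)
  (eps sigma alpha : R) :
  (exists H, F H) ->
  (2 <= r)%N ->
  family_chromatic F r.+1 ->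
  0 < eps -> eps < 1 / 2 ->
  0 < sigma -> sigma < eps ^+ 3 / 7 ->
  0 <= alpha -> alpha <= 1 - 1 / r%:R - eps ->
  (exists N : nat, (0 < N)%N /\ forall n : nat, (N < n)%N ->
      `| (ex F n)%:R - (ex F n.-1)%:R - turan_density F * n%:R | <= sigma * n%:R
      /\ `| lambda_Gprime F eps alpha n - 2 * (ex F n)%:R / n%:R | <= sigma) ->
  exists n0 : nat, (0 < n0)%N /\ forall (n : nat) (G : hgraph n),
    (n0 <= n)%N -> simpleb G -> Ffree F G ->
    lambda_alpha alpha G <= lambda_Gprime F eps alpha n /\
    (lambda_alpha alpha G = lambda_Gprime F eps alpha n -> inGprime F eps G).
Proof.
move=> _ r2 Fr eps0 eps2 sigma0 sigma_lt alpha0 alpha_le [N [_ hN]].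
(* The Turan graph bound turns the hypothesis on [alpha] into [alpha <= pi - eps], the form used in
   the descent. *)
have pi_ge := @turan_density_ge R F r r2 Fr.
have r1 : 1 <= r%:R :> R by rewrite ler1n ltnW.
have ri : 0 <= 1 - 1 / r%:R :> R.
  by rewrite div1r subr_ge0 invf_le1 // (lt_le_trans ltr01).
have ri1 : 1 - 1 / r%:R <= 1 :> R by rewrite gerDl oppr_le0 div1r invr_ge0.
have alpha_le_pi : alpha <= turan_density F - eps.
  by apply: le_trans alpha_le _; rewrite lerD2r.
have alpha_le1 : alpha <= 1.
  by apply: le_trans alpha_le _; rewrite lerBlDr ler_wpDr // ltW.
have [N' hN'] := @ex_density_le_near R F sigma sigma0.
have B0 : 0 <= 10 * (3 + sigma) / eps.
  by rewrite divr_ge0 ?(ltW eps0) // mulr_ge0 // addr_ge0 // ltW.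
have [B hB] : exists B : nat, 10 * (3 + sigma) / eps <= B%:R.
  by exists (Num.bound (10 * (3 + sigma) / eps)); apply/ltW/archi_boundP.
pose M := (N.+1 + N' + B)%N.
have NM n : (M <= n)%N -> (N < n)%N by rewrite /M; clear; lia.
have BM : 10 * (3 + sigma) / eps <= M%:R.
  by apply: le_trans hB _; rewrite ler_nat leq_addl.
have N'M n : (M <= n)%N -> (N' <= n)%N by rewrite /M; clear; lia.
have [n0 hn0] := @exceptional_bounded_order R F eps sigma alpha eps0 eps2 sigma0 sigma_lt
  alpha0 alpha_le_pi alpha_le1 (le_trans ri pi_ge) (turan_density_le2 F) M
  BM (fun n Mn => (hN n (NM n Mn)).1) (fun n Mn => (hN n (NM n Mn)).2)
  (fun n Mn => hN' n (N'M n Mn)).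
exists (n0 + N.+1)%N; split; first by rewrite addnS.
move=> n G nn sG FG.
have [n0n Nn] : (n0 <= n)%N /\ (N < n)%N by move: nn; clear; lia.
(* A graph outside the class that reaches [lambda_Gprime] would be exceptional. This settles the
   equality case, and also the inequality, since a graph inside the class never exceeds the
   maximum. *)
have Gp : lambda_Gprime F eps alpha n <= lambda_alpha alpha G -> inGprime F eps G.
  move=> ge; apply: contrapT => nG; apply: (hn0 n G n0n); split=> //.
  apply: le_trans ge; have := (hN n Nn).2; rewrite ler_norml => /andP[h _].
  by rewrite addrC -lerBrDr.
split; last by move=> e; apply: Gp; rewrite e.
rewrite leNgt; apply/negP => lt; move: (lt); rewrite ltNge => /negP; apply.
exact: lambda_alpha_le_Gprime (Gp (ltW lt)).
Qed.
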